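(* Let $m\ge 2$ and $n\ge 1$ be integers. Let $\operatorname{TSRP}(m,n,2)$ be the set of primitive TSR matrices of order $n$ over $\mathbb{F}_{2^m}$ and $\Psi_P(\operatorname{TSRP}(m,n,2))=\{\det(XI_{mn}-T): T\in\operatorname{TSRP}(m,n,2)\}$. Then $$\left|\operatorname{TSRP}(m,n,2)\right| = \left|\Psi_P\left(\operatorname{TSRP}(m,n,2)\right)\right| \prod_{i=1}^{m-1}(2^m-2^i).$$
   Context: A polynomial of degree $d$ over a finite field $\mathbb{F}_Q$ is primitive if it is monic and irreducible and one (equivalently every) root generates $\mathbb{F}_{Q^d}^*$. A TSR matrix of order $n$ over $\mathbb{F}_{2^m}$ is an $mn\times mn$ block matrix over $\mathbb{F}_2$ with $m\times m$ blocks of the form $$T=\begin{pmatrix} \mathbf{0} & \mathbf{0} & \cdots & \mathbf{0} & c_0A\\ I_m & \mathbf{0} & \cdots & \mathbf{0} & c_1A\\ \mathbf{0} & I_m & \cdots & \mathbf{0} & c_2A\\ \vdots & & \ddots & & \vdots\\ \mathbf{0} & \mathbf{0} & \cdots & I_m & c_{n-1}A\end{pmatrix},$$ with $c_0,\dots,c_{n-1}\in\mathbb{F}_2$ and $A\in M_m(\mathbb{F}_2)$. It is primitive if $\det(XI_{mn}-T)\in\mathbb{F}_2[X]$ is a primitive polynomial of degree $mn$ over $\mathbb{F}_2$; $\operatorname{TSRP}(m,n,2)$ is the set of all such primitive matrices. *)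

(* Defs.v *)
From HB Require Import structures.
From mathcomp Require Import all_boot all_order all_fingroup all_algebra.
From mathcomp Require Import all_solvable all_field.
From mathcomp Require Import finmap.

Set Implicit Arguments.
Unset Strict Implicit.
Unset Printing Implicit Defensive.

Import GRing.Theory.
Local Open Scope ring_scope.

(* [primitive_poly] is stated in qfpoly with the divisibilities p %| 'X^k - 1. *)
(* For p monic irreducible of degree d over F, it amounts to: a root x of p    *)
(* generates the multiplicative group of the field L with #|F| ^ d elements.   *)
(* The condition x != 0 only excludes p = 'X over F_2.                         *)
Lemma primitive_poly_root (F L : finFieldType) (f : {rmorphism F -> L})
    (p : {poly F}) (x : L) :
  p \is monic -> irreducible_poly p -> #|L| = (#|F| ^ (size p).-1)%N ->
  root (map_poly f p) x ->
  primitive_poly p <->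
  (x != 0 /\ forall y : L, y != 0 -> exists k : nat, y = x ^+ k).
Proof.
move=> pM pI cL px.
have dvdX n : (p %| 'X^n - 1) = (x ^+ n == 1).
  rewrite -subr_eq0.
  have -> : (x ^+ n - 1 == 0) = root (map_poly f ('X^n - 1)) x.
    by rewrite rmorphB /= map_polyXn rmorph1 rootE !hornerE.
  apply/idP/idP => [/dvdpP[r ->]|qx].
    by rewrite rmorphM /= rootM px orbT.
  apply: contraT; rewrite -irreducible_poly_coprime //.
  rewrite -(coprimep_map f) => /coprimep_root/(_ px).
  by rewrite -[_.[x] == 0]/(root _ x) qx.
have vE : (#|{poly %/ p}|).-1 = #|L|.-1 by rewrite card_monic_qpoly ?cL //; case: pI.
have L1 : (1 < #|L|)%N := card_finNzRing_gt1 L.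
have v0 : (0 < #|L|.-1)%N by rewrite -ltnS prednK // ltnW.
have Lv (y : L) : y != 0 -> y ^+ #|L|.-1 = 1.
  move=> y0; apply: (mulfI y0); rewrite -exprS prednK ?expf_card ?mulr1 //.
  exact: ltnW.
split=> [/primitive_polyP /=|[x0 xgen]].
  rewrite vE => -[_]; rewrite dvdX => /eqP xv xmin.
  have x0 : x != 0.
    by apply/eqP=> x0; move/eqP: xv; rewrite x0 expr0n eqn0Ngt v0 eq_sym oner_eq0.
  split=> // y y0.
  have prx : (#|L|.-1).-primitive_root x.
    rewrite /primitive_root_of_unity v0; apply/forallP => i; apply/eqP.
    rewrite unity_rootE; have [-> |ne] := eqVneq i.+1 #|L|.-1; first exact/eqP.
    rewrite -dvdX; apply/negbTE/xmin; rewrite /= ltn_neqAle ne.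
    exact: (ltn_ord i).
  by have [k ->] := prim_rootP prx (Lv y y0); exists k.
apply/primitive_polyP; rewrite /= vE; split=> [//||n /andP[n0 nv]].
  by rewrite dvdX Lv.
rewrite dvdX; apply/negP => /eqP xn.
suff : (#|predC1 (0%R : L)| <= n)%N by rewrite cardC1 leqNgt nv.
rewrite -[n in (_ <= n)%N]card_ord.
apply: leq_trans (leq_image_card (fun i : 'I_n => x ^+ i) predT).
apply/subset_leq_card/subsetP => y /xgen[k ->].
apply/imageP; exists (Ordinal (ltn_pmod k n0)) => //=.
by rewrite (expr_mod _ xn).
Qed.

(* The index type is \sum_(i < n) m, i.e. n * m, as for every \mxblock.        *)
(* When n = 1 the only block is c 0 *: A.                                      *)
Definition tsr_mx (m n : nat) (c : {ffun 'I_n -> 'F_2}) (A : 'M['F_2]_m) :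
    'M['F_2]_(\sum_(i < n) m) :=
  \mxblock_(i < n, j < n)
    (if j.+1 == n then c i *: A
     else if i == j.+1 :> nat then 1%:M else 0 : 'M_m).

Definition TSRP (m n : nat) : {set 'M['F_2]_(\sum_(i < n) m)} :=
  [set T | [exists c : {ffun 'I_n -> 'F_2}, [exists A : 'M['F_2]_m,
              T == tsr_mx c A]]
         & primitive_poly (char_poly T)].

Definition PsiP_TSRP (m n : nat) : {fset {poly 'F_2}} :=
  [fset char_poly T | T in TSRP m n]%fset.

(* Main.v *)
Require Import Defs.
From mathcomp Require Import all_boot all_algebra all_field finmap.

(* Write g = sum_i c_i X^i. A nonzero x is an eigenvalue of T = tsr_mx c A iff *)
(* b = x^n / g(x) is an eigenvalue of A. If char_poly T is irreducible, then x *)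
(* has degree m n over F_2 while b has degree at most m and x has degree at    *)
(* most n over F_2(b); so char_poly A is the minimal polynomial of b over F_2, *)
(* and X^n - b g that of x over F_2(b). As F_2(b) is the only subfield of      *)
(* degree m and the c_i are 0 or 1, x determines c and b. Hence the T with a   *)
(* given primitive characteristic polynomial share one c, and their A range    *)
(* over all matrices with one irreducible characteristic polynomial f. For a   *)
(* fixed e0 != 0 and A0 with characteristic polynomial f, the map              *)
(* P |-> (e0 P, P^-1 A0 P) is a bijection from GL_m onto pairs (e, A) with     *)
(* e != 0 and char_poly A = f, so there are |GL_m| / (2^m - 1) such A.         *)

Set Implicit Arguments.
Unset Strict Implicit.
Unset Printing Implicit Defensive.

Import GRing.Theory.
Local Open Scope ring_scope.

(** The theorem is a fibre count: [char_poly] maps [TSRP m n] onto [PsiP_TSRP m n], and every fibre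
    has [\prod_(1 <= i < m) (2 ^ m - 2 ^ i)] elements ([card_TSRP_fiber]). [minPoly_tsr] is the
    field-theoretic core; from it [char_tsr_inj] and [char_tsr_eq] identify a fibre with the
    matrices [A] having one irreducible characteristic polynomial, and [card_char_poly_GL] counts
    these through cyclic vectors. *)

(** * Eigenvalues of TSR matrices and minimal polynomials *)

Definition tsr_poly (n : nat) (c : {ffun 'I_n -> 'F_2}) : {poly 'F_2} :=
  rVpoly (\row_i c i).

Lemma coef_tsr_poly n (c : {ffun 'I_n -> 'F_2}) (i : 'I_n) :
  (tsr_poly c)`_i = c i.
Proof. by rewrite coef_rVpoly_ord mxE. Qed.

Lemma size_tsr_poly n (c : {ffun 'I_n -> 'F_2}) : (size (tsr_poly c) <= n)%N.
Proof. exact: size_poly. Qed.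

Lemma mulmx_mxrow_tsr (L : fieldType) (f : {rmorphism 'F_2 -> L}) m n
    (c : {ffun 'I_n.+1 -> 'F_2}) (A : 'M['F_2]_m) (v : 'I_n.+1 -> 'rV[L]_m) :
  (\mxrow_(i < n.+1) v i) *m map_mx f (tsr_mx c A) =
  \mxrow_(j < n.+1) (if j.+1 == n.+1
    then (\sum_i f (c i) *: v i) *m map_mx f A else v (inord j.+1)).
Proof.
have -> : map_mx f (tsr_mx c A) = \mxblock_(i < n.+1, j < n.+1)
    map_mx f (if j.+1 == n.+1 then c i *: A
     else if i == j.+1 :> nat then 1%:M else 0).
  by apply/matrixP=> i j; rewrite !mxE.
rewrite mul_mxrow_mxblock; apply/eq_mxrowP=> j.
case: ifPn => [_|jn].
  rewrite mulmx_suml; apply: eq_bigr => i _.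
  by rewrite map_mxZ -scalemxAr scalemxAl.
have jn1 : (j.+1 < n.+1)%N by rewrite ltn_neqAle jn ltn_ord.
rewrite (bigD1 (inord j.+1)) //= inordK // eqxx map_mx1 mulmx1 big1 ?addr0 // => i.
rewrite -val_eqE /= inordK // => /negbTE->.
by rewrite map_mx0 mulmx0.
Qed.

(* A row eigenvector of [tsr_mx c A] has the form (w, x w, ..., x^(n-1) w). *)
Lemma root_char_tsr (L : fieldType) (f : {rmorphism 'F_2 -> L}) m n
    (c : {ffun 'I_n.+1 -> 'F_2}) (A : 'M['F_2]_m) (x : L)
    (g := (map_poly f (tsr_poly c)).[x]) : x != 0 ->
  root (map_poly f (char_poly (tsr_mx c A))) x =
  (g != 0) && root (map_poly f (char_poly A)) (x ^+ n.+1 / g).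
Proof.
move=> x0; rewrite !map_char_poly -!eigenvalue_root_char.
have gE : g = \sum_i f (c i) * x ^+ i.
  rewrite /g (@horner_coef_wide _ n.+1) ?size_map_poly ?size_tsr_poly //.
  by apply: eq_bigr => i _; rewrite coef_map coef_tsr_poly.
have sumE (w : 'rV[L]_m) : \sum_(i < n.+1) f (c i) *: (x ^+ i *: w) = g *: w.
  by rewrite gE scaler_suml; apply: eq_bigr => i _; rewrite scalerA.
apply/eigenvalueP/andP => [[v vT v0]|[g0 /eigenvalueP[w wA w0]]].
  move: vT; rewrite -(submxrowK v) mulmx_mxrow_tsr.
  have -> : x *: \mxrow_j submxrow v j = \mxrow_j (x *: submxrow v j).
    by apply/matrixP=> i j; rewrite !mxE.
  move/eq_mxrowP=> vT; set w := submxrow v ord0.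
  have uE (i : nat) : (i < n.+1)%N -> submxrow v (inord i) = x ^+ i *: w.
    elim: i => [|i IH] ilt; first
      by rewrite expr0 scale1r; congr submxrow; apply/val_inj; rewrite /= inordK.
    have := vT (inord i); rewrite inordK ?(ltnW ilt) // ltn_eqF // => ->.
    by rewrite IH ?(ltnW ilt) // exprS scalerA.
  have uE' (i : 'I_n.+1) : submxrow v i = x ^+ i *: w.
    by rewrite -uE // inord_val.
  have w0 : w != 0.
    apply: contraNneq v0 => w0; rewrite -(submxrowK v).
    apply/eqP; rewrite -[RHS]mxrow0; apply/eq_mxrowP => i.
    by rewrite uE' w0 scaler0.
  (* The last block column reads g(x) (w A) = x^(n+1) w. *)
  have := vT ord_max; rewrite eqxx /= uE'; under eq_bigr do rewrite uE'.
  rewrite sumE scalerA -exprS -scalemxAl => gw.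
  have g0 : g != 0.
    apply: contraNneq w0 => g0; move: gw; rewrite g0 scale0r => /esym/eqP.
    by rewrite scaler_eq0 expf_eq0 (negbTE x0) andbF.
  split=> //; apply/eigenvalueP; exists w => //.
  by apply: (scalerI g0); rewrite gw scalerA mulrC divfK.
exists (\mxrow_(i < n.+1) (x ^+ i *: w)).
  rewrite (mulmx_mxrow_tsr f c A (fun i => x ^+ i *: w)).
  have -> : x *: \mxrow_(j < n.+1) (x ^+ j *: w) =
      \mxrow_(j < n.+1) (x *: (x ^+ j *: w)).
    by apply/matrixP=> i j; rewrite !mxE.
  apply/eq_mxrowP => j; rewrite scalerA -exprS; case: ifPn => [/eqP->|jn].
    by rewrite sumE -scalemxAl wA scalerA mulrC divfK.
  by rewrite inordK // ltn_neqAle jn ltn_ord.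
apply: contraNneq w0 => /(congr1 (fun u => submxrow u ord0)).
by rewrite mxrowK expr0 scale1r submxrow0 => ->.
Qed.

(** A degree squeeze in the tower 1, [<<1; b>>], L: monic annihilating polynomials bound the two
    steps by [m.+1] and [n.+1], while the degrees multiply to [m.+1 * n.+1]. Both bounds are
    therefore equalities, and each annihilating polynomial is the minimal one. *)
Lemma minPoly_tsr (L : fieldExtType 'F_2) m n
    (c : {ffun 'I_n.+1 -> 'F_2}) (A : 'M['F_2]_m.+1) (x : L)
    (g := map_poly (in_alg L) (tsr_poly c)) (b := x ^+ n.+1 / g.[x]) :
  x != 0 -> root (map_poly (in_alg L) (char_poly (tsr_mx c A))) x ->
  <<1; x>>%VS = fullv -> \dim {:L} = (m.+1 * n.+1)%N ->
  [/\ g.[x] != 0, \dim <<1; b>>%VS = m.+1,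
      minPoly 1 b = map_poly (in_alg L) (char_poly A) &
      minPoly <<1; b>> x = 'X^(n.+1) - b *: g].
Proof.
move=> x0; rewrite root_char_tsr // => /andP[gx0]; rewrite -/g -/b => rb genx dimL.
have cAM : map_poly (in_alg L) (char_poly A) \is monic.
  by rewrite monic_map ?char_poly_monic.
have cAsz : size (map_poly (in_alg L) (char_poly A)) = m.+2.
  by rewrite size_map_poly size_char_poly.
have cAO : map_poly (in_alg L) (char_poly A) \is a polyOver 1%VS.
  by apply/polyOverP => i; rewrite coef_map /= rpredZ ?rpred1.
have bK : b \in <<1; b>>%VS by exact: memv_adjoin.
have gO (K : {subfield L}) : g \is a polyOver K.
  by apply/polyOverP => i; rewrite coef_map /= rpredZ ?rpred1.
set q := 'X^(n.+1) - b *: g.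
have qO : q \is a polyOver <<1; b>>%VS.
  apply: rpredB; first by apply: rpredX; exact: polyOverX.
  exact: polyOverZ bK (gO <<1; b>>%AS).
have szbg : (size (- (b *: g)) <= n.+1)%N.
  rewrite size_polyN (leq_trans (size_scale_leq _ _)) // size_map_poly.
  exact: size_tsr_poly.
have szq : size q = n.+2 by rewrite size_polyDl size_polyXn // ltnS.
have qM : q \is monic.
  by rewrite monicE lead_coefDl ?lead_coefXn ?size_polyXn // ltnS.
have rq : root q x by rewrite rootE !hornerE /b divfK ?subrr.
have d1 := minPoly_dvdp cAO rb.
have d2 := minPoly_dvdp qO rq.
have le1 : (adjoin_degree 1 b <= m.+1)%N.
  by rewrite -ltnS -size_minPoly -cAsz dvdp_leq ?monic_neq0.
have le2 : (adjoin_degree <<1; b>> x <= n.+1)%N.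
  by rewrite -ltnS -size_minPoly -szq dvdp_leq ?monic_neq0.
have dimE : (m.+1 * n.+1 = adjoin_degree <<1; b>> x * adjoin_degree 1 b)%N.
  rewrite -dimL; have -> : {:L}%VS = <<<<1; b>>; x>>%VS.
    apply/eqP; rewrite eqEsubv subvf andbT -genx.
    by rewrite adjoinSl // sub1v.
  by rewrite dim_Fadjoin dim_Fadjoin dimv1 muln1.
have e1 : adjoin_degree 1 b = m.+1.
  apply/eqP; rewrite eqn_leq le1 /= -(leq_pmul2r (ltn0Sn n)) dimE mulnC.
  by rewrite leq_mul2l le2 orbT.
have e2 : adjoin_degree <<1; b>> x = n.+1.
  by apply/eqP; rewrite -(eqn_pmul2l (ltn0Sn m)) dimE e1 mulnC.
split=> //; first by rewrite dim_Fadjoin e1 dimv1 muln1.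
  apply/eqP; rewrite -eqp_monic ?monic_minPoly //.
  by rewrite -dvdp_size_eqp // size_minPoly e1 cAsz.
apply/eqP; rewrite -eqp_monic ?monic_minPoly //.
by rewrite -dvdp_size_eqp // size_minPoly e2 szq.
Qed.

(** * What the characteristic polynomial of a TSR matrix determines *)

Lemma F2_neq0 (a : 'F_2) : a != 0 -> a = 1.
Proof. by case: a => [[|[|k]]] //= klt _; apply/val_inj. Qed.

Lemma F2_eq (a b : 'F_2) : (a == 0) = (b == 0) -> a = b.
Proof.
have [->|/F2_neq0->] := eqVneq a 0; last by move/esym/negbT/F2_neq0.
by move/esym/eqP.
Qed.

Lemma irredp_FAdjoin_neq0 (F : fieldType) (p : {poly F}) :
  irreducible_poly p -> ~~ root p 0 ->
  {L : fieldExtType F & \dim {:L} = (size p).-1 &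
    {x : L | x != 0 /\ root (map_poly (in_alg L) p) x & <<1; x>>%VS = fullv}}.
Proof.
move=> pI p0; have [L dimL [x rx genx]] := irredp_FAdjoin pI.
exists L => //; exists x => //; split=> //.
apply: contraNneq p0 => x0; move: rx.
by rewrite x0 -[in X in X -> _](rmorph0 (in_alg L)) fmorph_root.
Qed.

(** A subfield of dimension d consists of the solutions of a^(q^d) = a, where q = [#|F|]. *)
Lemma eq_subfield_dim (F : finFieldType) (L : fieldExtType F) (K E : {subfield L}) :
  \dim K = \dim E -> K = E :> {vspace L}.
Proof. by move=> eqd; apply/vspaceP => a; rewrite !Fermat's_little_theorem eqd. Qed.

Lemma sum_const_ord m n : (\sum_(i < n) m)%N = (m * n)%N.
Proof. by rewrite sum_nat_const card_ord mulnC. Qed.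

Lemma char_tsr_inj m n (c c' : {ffun 'I_n.+1 -> 'F_2}) (A A' : 'M['F_2]_m.+1) :
  irreducible_poly (char_poly (tsr_mx c A)) ->
  ~~ root (char_poly (tsr_mx c A)) 0 ->
  char_poly (tsr_mx c' A') = char_poly (tsr_mx c A) ->
  c' = c /\ char_poly A' = char_poly A.
Proof.
move=> pI p0 eqp; have [L dimL [x [x0 rx] genx]] := irredp_FAdjoin_neq0 pI p0.
rewrite size_char_poly sum_const_ord /= in dimL.
have [g0 dK mb mx] := minPoly_tsr x0 rx genx dimL.
rewrite -eqp in rx.
have [g0' dK' mb' mx'] := minPoly_tsr x0 rx genx dimL.
move: g0 dK mb mx g0' dK' mb' mx'.
set g := map_poly _ (tsr_poly c); set g' := map_poly _ (tsr_poly c').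
set b := _ / g.[x]; set b' := _ / g'.[x] => g0 dK mb mx g0' dK' mb' mx'.
have b0 : b != 0 by rewrite mulf_neq0 ?invr_eq0 ?expf_neq0.
have b0' : b' != 0 by rewrite mulf_neq0 ?invr_eq0 ?expf_neq0.
have eqK : <<1; b>>%VS = <<1; b'>>%VS by apply: eq_subfield_dim; rewrite dK dK'.
(* Both sides come from the minimal polynomial of the same [x] over the same field. *)
have bg : b *: g = b' *: g'.
  by apply/oppr_inj/(addrI 'X^(n.+1)); rewrite -mx -mx' eqK.
have bc i : b * (c i)%:A = b' * (c' i)%:A.
  by move/(congr1 (coefp i)): bg; rewrite /= !coefZ !coef_map !coef_tsr_poly.
(* As [b] and [b'] are nonzero, [c] and [c'] vanish at the same indices, which determines them over
   F_2. *)
have eqc : c' = c.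
  apply/ffunP => i; apply: F2_eq; apply: esym.
  have := congr1 (eq_op^~ 0) (bc i).
  rewrite /= (mulf_eq0 b) (mulf_eq0 b') (negbTE b0) (negbTE b0') /=.
  by rewrite !scaler_eq0 oner_eq0 !orbF.
have bb : b' = b by rewrite /b' /b /g' /g eqc.
split; first exact: eqc.
apply: (map_poly_inj (in_alg L)).
exact: etrans (esym mb') (etrans (congr1 _ bb) mb).
Qed.

Lemma monic_irredp_eq (F L : fieldType) (f : {rmorphism F -> L}) (p q : {poly F})
    (x : L) : p \is monic -> q \is monic -> irreducible_poly p ->
  size q = size p -> root (map_poly f p) x -> root (map_poly f q) x -> q = p.
Proof.
move=> pM qM pI eqsz rp rq; apply/esym/eqP; rewrite -eqp_monic //.
rewrite -dvdp_size_eqp ?eqsz //; apply: contraT.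
rewrite -irreducible_poly_coprime // -(coprimep_map f) => /coprimep_root/(_ rp).
by rewrite -[_.[x] == 0]/(root _ x) rq.
Qed.

(** The criterion [root_char_tsr] sees [A] only through [char_poly A], so both characteristic
    polynomials share the root [x]; they are monic of equal degree and one is irreducible. *)
Lemma char_tsr_eq m n (c : {ffun 'I_n.+1 -> 'F_2}) (A A' : 'M['F_2]_m.+1) :
  irreducible_poly (char_poly (tsr_mx c A)) ->
  ~~ root (char_poly (tsr_mx c A)) 0 -> char_poly A' = char_poly A ->
  char_poly (tsr_mx c A') = char_poly (tsr_mx c A).
Proof.
move=> pI p0 eqA; have [L _ [x [x0 rx] _]] := irredp_FAdjoin_neq0 pI p0.
have rx' : root (map_poly (in_alg L) (char_poly (tsr_mx c A'))) x.
  rewrite (root_char_tsr (in_alg L) c A' x0) eqA.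
  by rewrite -(root_char_tsr (in_alg L) c A x0).
apply: (monic_irredp_eq (char_poly_monic _) (char_poly_monic _) pI _ rx rx').
exact: etrans (size_char_poly _) (esym (size_char_poly _)).
Qed.

Lemma tsr_mx_inj m n (c : {ffun 'I_n.+1 -> 'F_2}) :
  tsr_poly c != 0 -> injective (@tsr_mx m n.+1 c).
Proof.
move=> c0 A A'; rewrite /tsr_mx => /eq_mxblockP eqb.
have [i ci] : exists i, c i != 0.
  apply/existsP; apply: contraR c0 => /existsPn c0; apply/eqP/polyP => k.
  rewrite coef0; have [kn|nk] := ltnP k n.+1; last first.
    by rewrite nth_default // (leq_trans (size_tsr_poly c)).
  by have /negPn/eqP := c0 (Ordinal kn); rewrite -coef_tsr_poly.
by have := eqb i ord_max; rewrite eqxx (F2_neq0 ci) !scale1r.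
Qed.

Lemma primitive_poly_unroot0 (F : finFieldType) (p : {poly F}) :
  primitive_poly p -> irreducible_poly p /\ ~~ root p 0.
Proof.
move=> /primitive_polyP /= [[pI pM] pv _]; split=> //.
have F1 : (1 < #|F|)%N := card_finNzRing_gt1 F.
have p1 : (1 < size p)%N by case: pI.
have v0 : (0 < #|{poly %/ p}|.-1)%N.
  rewrite card_monic_qpoly // -subn1 subn_gt0 -[1%N in X in (X < _)%N](expn0 #|F|).
  by rewrite ltn_exp2l // -subn1 subn_gt0.
apply/negP => /(root_dvdp pv).
by rewrite rootE !hornerE expr0n eqn0Ngt v0 sub0r oppr_eq0 oner_eq0.
Qed.

(** * Cyclic bases and conjugation *)

Section Krylov.

Variables (F : fieldType) (m : nat).
Implicit Types (u e : 'rV[F]_m.+1) (A P : 'M[F]_m.+1).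

Definition krylov_mx e A : 'M[F]_m.+1 := \matrix_(i < m.+1) (e *m A ^+ i).

Lemma mul_krylov_mx u e A : u *m krylov_mx e A = e *m horner_mx A (rVpoly u).
Proof.
rewrite mulmx_sum_row [u in RHS]row_sum_delta (linear_sum rVpoly).
rewrite (linear_sum (horner_mx A)) /= mulmx_sumr; apply: eq_bigr => i _.
rewrite rowK linearZ /= rVpoly_delta linearZ /= rmorphXn /= horner_mx_X.
by rewrite -scalemxAr.
Qed.

(** A linear relation among the rows is a polynomial h with e h(A) = 0 and degree below that of
    [char_poly A]. If h is nonzero, it is coprime to [char_poly A], so Bezout makes h(A) invertible
    and forces e = 0. *)
Lemma krylov_mx_unit e A :
  irreducible_poly (char_poly A) -> e != 0 -> krylov_mx e A \in unitmx.
Proof.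
move=> fI e0; rewrite -row_free_unit; apply: inj_row_free => u.
rewrite mul_krylov_mx => eu; apply/eqP; apply: contraNT e0 => u0.
have h0 : rVpoly u != 0.
  by apply: contra u0 => /eqP h0; rewrite -(rVpolyK u) h0 linear0.
have : coprimep (char_poly A) (rVpoly u).
  rewrite irreducible_poly_coprime //; apply/negP => /(dvdp_leq h0).
  by rewrite size_char_poly ltnNge size_poly.
case/Bezout_eq1_coprimepP=> -[a b] /= /(congr1 (horner_mx A)).
rewrite rmorphD !rmorphM rmorph1 /= Cayley_Hamilton mulr0 add0r => ab.
rewrite -[e]mulmx1 -[1%:M]ab comm_horner_mx2 -mulmxE mulmxA eu.
by rewrite mul0mx.
Qed.

Lemma krylov_mx_conj e A P : P \in unitmx ->
  krylov_mx (e *m P) (invmx P *m A *m P) = krylov_mx e A *m P.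
Proof.
move=> Pu; apply/row_matrixP => i; rewrite row_mul !rowK.
have -> : (invmx P *m A *m P) ^+ i = invmx P *m (A ^+ i) *m P.
  elim: (nat_of_ord i) => [|k IH]; first by rewrite !expr0 mulmx1 mulVmx.
  by rewrite !exprSr IH -!mulmxE !mulmxA mulmxK.
by rewrite !mulmxA mulmxK.
Qed.

(* The left factor depends on [A] only through its characteristic polynomial. *)
Lemma krylov_mx_shift e A : krylov_mx e A *m A =
  (\matrix_(i < m.+1) poly_rV ('X^(i.+1) %% char_poly A)) *m krylov_mx e A.
Proof.
apply/row_matrixP => i; rewrite !row_mul !rowK mul_krylov_mx poly_rV_K; last first.
  by rewrite -ltnS -(size_char_poly A) ltn_modp monic_neq0 ?char_poly_monic.
rewrite -mulmxA mulmxE -exprSr; congr (_ *m _).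
rewrite -[A in LHS]horner_mx_X -rmorphXn /= {1}(divp_eq 'X^(i.+1) (char_poly A)).
by rewrite rmorphD rmorphM /= Cayley_Hamilton mulr0 add0r.
Qed.

Lemma char_poly_conj A P : P \in unitmx ->
  char_poly (invmx P *m A *m P) = char_poly A.
Proof.
move=> Pu; pose Q := map_mx polyC P; pose Q' := map_mx polyC (invmx P).
have QQ : Q' *m Q = 1%:M by rewrite -map_mxM mulVmx // map_mx1.
have -> : char_poly (invmx P *m A *m P) = \det (Q' *m char_poly_mx A *m Q).
  congr (\det _); rewrite /char_poly_mx !map_mxM mulmxBr mulmxBl.
  by rewrite mul_mx_scalar -scalemxAl QQ scalemx1.
by rewrite !det_mulmx mulrAC -det_mulmx QQ det1 mul1r.
Qed.

End Krylov.

(** * Counting matrices with a given irreducible characteristic polynomial *)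

Lemma card_char_poly_GL (F : finFieldType) m (A0 : 'M[F]_m.+1) :
  irreducible_poly (char_poly A0) ->
  (#|[set A : 'M[F]_m.+1 | char_poly A == char_poly A0]| * (#|F| ^ m.+1 - 1))%N =
  #|'GL_m.+1[F]%g|.
Proof.
move=> fI; pose e0 : 'rV[F]_m.+1 := const_mx 1.
have e00 : e0 != 0.
  by apply/eqP => /rowP/(_ ord0); rewrite !mxE => /eqP; rewrite oner_eq0.
have K0 := krylov_mx_unit fI e00.
pose phi (P : {'GL_m.+1[F]}) : 'rV[F]_m.+1 * 'M[F]_m.+1 :=
  (e0 *m GLval P, invmx (GLval P) *m A0 *m GLval P).
have GLu (P : {'GL_m.+1[F]}) : GLval P \in unitmx by exact: GL_unit.
(* By [krylov_mx_conj], the image pair determines [krylov_mx e0 A0 *m P], hence [P]. *)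
have phi_inj : injective phi.
  move=> P Q [eqe eqA]; apply/val_inj/(can_inj (mulKmx K0)).
  by rewrite /= -!krylov_mx_conj ?GLu // eqe eqA.
have -> : (#|F| ^ m.+1 - 1)%N = #|[set e : 'rV[F]_m.+1 | e != 0]|.
  by rewrite cardsE cardC1 card_mx mul1n subn1.
rewrite mulnC -cardsX -[RHS](card_imset _ phi_inj); apply: eq_card => -[e A].
rewrite inE /= !inE /=; apply/andP/imsetP => [[e_n0 /eqP cA]|[P _ [-> ->]]]; last first.
  split; last by rewrite char_poly_conj ?GLu.
  by apply: contra e00 => /eqP eP; rewrite -(mulmxK (GLu P) e0) eP mul0mx.
have K1 : krylov_mx e A \in unitmx by apply: krylov_mx_unit; rewrite ?cA.
(* The preimage of (e, A) is the change of basis taking each e0 A0^i to e A^i. It conjugates [A0] to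
   [A] because, by [krylov_mx_shift], both act by the same matrix in their cyclic bases. *)
have Pu : invmx (krylov_mx e0 A0) *m krylov_mx e A \is a GRing.unit.
  by rewrite -[_ \is a _]/(_ \in unitmx) unitmx_mul unitmx_inv K0.
exists (FinRing.Unit Pu); first by rewrite inE.
rewrite /phi /=; congr (_, _).
  have row0 e' (A' : 'M[F]_m.+1) : row ord0 (krylov_mx e' A') = e'.
    by rewrite rowK expr0 mulmx1.
  by rewrite -{1}(row0 e A) -{1}(row0 e0 A0) -row_mul mulKVmx.
rewrite -[LHS](mulKmx Pu) -[RHS]mulmxA; congr (_ *m _).
rewrite -mulmxA krylov_mx_shift cA; apply: (canLR (mulKmx K0)).
by rewrite mulmxA krylov_mx_shift -mulmxA mulKVmx.
Qed.

(** The left side is the order of GL over a field with q elements. Writing the power of q as the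
    product of the q^i and reversing the other product pairs the factors as q^i (q^(m+1-i) - 1) =
    q^(m+1) - q^i. *)
Lemma prod_expn_sub q m :
  (q ^ 'C(m.+1, 2) * \prod_(1 <= i < m.+2) (q ^ i - 1) =
   \prod_(1 <= i < m.+1) (q ^ m.+1 - q ^ i) * (q ^ m.+1 - 1))%N.
Proof.
rewrite big_nat_recr //= mulnA; congr (_ * _)%N.
rewrite -bin2_sum big_ltn // add0n expn_sum [X in (_ * X)%N]big_nat_rev /=.
rewrite -big_split /=; apply: eq_big_nat => i /andP[_ im].
by rewrite add1n subSS mulnBr muln1 -expnD subnKC // ltnW.
Qed.

Lemma card_irreducible_char_poly (F : finFieldType) m (A0 : 'M[F]_m.+1) :
  irreducible_poly (char_poly A0) ->
  #|[set A : 'M[F]_m.+1 | char_poly A == char_poly A0]| =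
  (\prod_(1 <= i < m.+1) (#|F| ^ m.+1 - #|F| ^ i))%N.
Proof.
move=> fI; apply/eqP; have F1 : (1 < #|F|)%N := card_finNzRing_gt1 F.
rewrite -(@eqn_pmul2r (#|F| ^ m.+1 - 1)) ?subn_gt0 -?(expn0 #|F|) ?ltn_exp2l //.
by rewrite expn0 card_char_poly_GL // card_GL // prod_expn_sub.
Qed.

(** * Fibres of the characteristic polynomial and the final count *)

Lemma minPoly_irreducible_base (F : fieldType) (L : fieldExtType F) (f : {poly F})
    (b : L) : minPoly 1 b = map_poly (in_alg L) f -> irreducible_poly f.
Proof.
move=> mb; split.
  by rewrite -(size_map_poly (in_alg L)) -mb size_minPoly ltnS.
move=> q q1 qf.
have qO : map_poly (in_alg L) q \is a polyOver 1%VS.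
  by apply/polyOverP => i; rewrite coef_map /= rpredZ ?rpred1.
have qd : map_poly (in_alg L) q %| minPoly 1 b by rewrite mb dvdp_map.
have := minPoly_irr qO qd; rewrite mb eqp_map => /orP[//|/eqp_size].
by rewrite size_poly1 size_map_poly => /eqP; rewrite (negbTE q1).
Qed.

Lemma tsr_irreducible m n (c : {ffun 'I_n.+1 -> 'F_2}) (A : 'M['F_2]_m.+1) :
  irreducible_poly (char_poly (tsr_mx c A)) ->
  ~~ root (char_poly (tsr_mx c A)) 0 ->
  tsr_poly c != 0 /\ irreducible_poly (char_poly A).
Proof.
move=> pI p0; have [L dimL [x [x0 rx] genx]] := irredp_FAdjoin_neq0 pI p0.
rewrite size_char_poly sum_const_ord /= in dimL.
have [g0 _ mb _] := minPoly_tsr x0 rx genx dimL.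
split; last exact: minPoly_irreducible_base mb.
by apply: contraNneq g0 => ->; rewrite rmorph0 horner0.
Qed.

Lemma card_TSRP_fiber m n (T : 'M['F_2]_(\sum_(i < n.+1) m.+1)) :
  T \in TSRP m.+1 n.+1 ->
  #|[set T' in TSRP m.+1 n.+1 | char_poly T' == char_poly T]| =
  (\prod_(1 <= i < m.+1) (2 ^ m.+1 - 2 ^ i))%N.
Proof.
rewrite inE => /andP[/existsP[c /existsP[A /eqP->]] pP].
have [pI p0] := primitive_poly_unroot0 pP.
have [c0 fI] := tsr_irreducible pI p0.
(* Primitivity of [T'] is inherited from [T], since it depends only on the characteristic
   polynomial. *)
have -> : [set T' in TSRP m.+1 n.+1 | char_poly T' == char_poly (tsr_mx c A)] =
    tsr_mx c @: [set A' : 'M['F_2]_m.+1 | char_poly A' == char_poly A].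
  apply/setP => T'; rewrite !inE; apply/andP/imsetP.
    case=> /andP[/existsP[c' /existsP[A' /eqP->]] _] /eqP eqp.
    have [-> eqA] := char_tsr_inj pI p0 eqp.
    exists A'; last exact: erefl.
    by rewrite inE; apply/eqP; exact: eqA.
  case=> A'; rewrite inE => /eqP eqA ->.
  have eqp := char_tsr_eq pI p0 eqA; split; last by apply/eqP; exact: eqp.
  apply/andP; split; last by rewrite eqp.
  by apply/existsP; exists c; apply/existsP; exists A'.
rewrite (card_imset _ (tsr_mx_inj c0)) card_irreducible_char_poly //.
by rewrite card_Fp.
Qed.

Lemma card_imfset_fiber (I : finType) (J : choiceType) (h : I -> J) (A : {set I}) k :
  (forall x, x \in A -> #|[set y in A | h y == h x]| = k) ->
  #|A| = (#|` [fset h x | x in A]%fset| * k)%N.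
Proof.
move=> fib; set S := [fset _ | _ in _]%fset.
(* Double counting of the pairs (x, h x): each x meets exactly one z in the duplicate-free [S], and
   each z in [S] meets k elements x. *)
transitivity (\sum_(x in A) \sum_(z <- S | h x == z) 1)%N.
  rewrite -sum1_card; apply: eq_bigr => x xA.
  rewrite sum1_count (eq_count (a2 := pred1 (h x))); last by move=> z; exact: eq_sym.
  by rewrite count_uniq_mem ?fset_uniq // in_imfset.
rewrite (exchange_big_dep predT) //= big_seq.
rewrite (eq_bigr (fun=> k)) => [|z /imfsetP[x /= xA ->]].
  by rewrite -big_seq big_const_seq count_predT iter_addn_0 mulnC.
rewrite -(fib x xA) -sum1_card; apply: eq_bigl => y.
by rewrite inE.
Qed.

Local Close Scope ring_scope.

Theorem theorem3p4 (m n : nat) (hm : 2 <= m) (hn : 1 <= n) :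
  #|TSRP m n| = #|` PsiP_TSRP m n| * \prod_(1 <= i < m) (2 ^ m - 2 ^ i).
Proof.
case: m hm => // m _; case: n hn => // n _.
exact: card_imfset_fiber (@card_TSRP_fiber m n).
Qed.
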